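(* Let $n\ge 3$ be an integer, let $G=GP(n,1)$ be the generalized Petersen graph, and let $\Gamma$ be an Abelian group of order $2n$. Then $G$ is not $\Gamma$-distance magic.
   Context: For positive integers $n,k$ with $1\le k<n/2$, the generalized Petersen graph $GP(n,k)$ is the graph on the $2n$ vertices $\{x_i,y_i: i\in\mathbb{Z}_n\}$ with edges $x_ix_{i+1}$, $y_iy_{i+k}$ and $x_iy_i$ for $i\in\mathbb{Z}_n$ (indices modulo $n$). For a graph $G=(V,E)$ and an Abelian group $\Gamma$ (written additively) of order $|V|$, a $\Gamma$-distance magic labeling of $G$ is a bijection $\ell: V\to\Gamma$ for which there is $\mu\in\Gamma$ such that $\sum_{y\in N(x)}\ell(y)=\mu$ for every $x\in V$, where $N(x)$ is the set of neighbors of $x$. $G$ is $\Gamma$-distance magic if such a labeling exists. *)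

(* Defs.v *)
From mathcomp Require Import all_boot all_order all_algebra.

Set Implicit Arguments.
Unset Strict Implicit.
Unset Printing Implicit Defensive.

Import GRing.Theory.
Local Open Scope ring_scope.

(* A finite simple graph is given by its adjacency relation, a symmetric and
   irreflexive relation on a finite type of vertices. *)

Definition neighbors (V : finType) (adj : rel V) (x : V) : {set V} :=
  [set y | adj x y].

(* No requirement #|Gamma| = #|V| appears: the bijection forces it. *)
Definition distance_magic_labeling (V : finType) (adj : rel V)
    (Gamma : finZmodType) (l : V -> Gamma) : Prop :=
  bijective l /\
  exists mu : Gamma, forall x : V, \sum_(y in neighbors adj x) l y = mu.

Definition distance_magic (V : finType) (adj : rel V) (Gamma : finZmodType) :
    Prop :=
  exists l : V -> Gamma, distance_magic_labeling adj l.

(* inl i is the vertex x_i and inr i is the vertex y_i. The type 'Z_n is the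
   ring of integers modulo n only for 1 < n, which holds whenever
   1 <= k < n / 2. *)
Definition GP_vertex (n : nat) : finType := ('Z_n + 'Z_n)%type.

Definition GP_adj (n k : nat) : rel (GP_vertex n) := fun u v =>
  match u, v with
  | inl i, inl j => (j == i + 1) || (i == j + 1)
  | inr i, inr j => (j == i + k%:R) || (i == j + k%:R)
  | inl i, inr j => i == j
  | inr i, inl j => i == j
  end.

Lemma card_GP_vertex (n : nat) : (1 < n)%N -> #|GP_vertex n| = (2 * n)%N.
Proof. by move=> n1; rewrite card_sum card_ord Zp_cast // addnn mul2n. Qed.

Lemma GP_adj_sym (n k : nat) : symmetric (@GP_adj n k).
Proof. by case=> i [] j //=; rewrite orbC. Qed.

Lemma GP_adj_irrefl (n k : nat) :
  (1 <= k)%N -> (2 * k < n)%N -> irreflexive (@GP_adj n k).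
Proof.
move=> k1 kn.
have n1 : (1 < n)%N by apply: leq_ltn_trans kn; rewrite mul2n double_gt0.
have kltn : (k < n)%N by apply: leq_ltn_trans kn; rewrite leq_pmull.
have k0 : (k%:R : 'Z_n) != 0.
  apply/eqP => /(congr1 val); rewrite /= val_Zp_nat // modn_small // => k00.
  by rewrite k00 in k1.
by case=> i /=; rewrite orbb eq_sym -subr_eq0 addrC addKr ?oner_neq0 ?(negbTE k0).
Qed.

(* Main.v *)
Require Import Defs.
From mathcomp Require Import all_boot all_order all_algebra.

(** The neighborhoods of two suitable vertices differ by a single exchange: in
    GP(n,1) the vertex x_1 is adjacent to x_0, y_1 and x_2, while y_0 is
    adjacent to x_0, y_1 and y_(-1). Both triples of labels have the same sum,
    so x_2 and y_(-1) carry the same label, although they are different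
    vertices. The general principle is [distance_magic_exchange]. *)

Import GRing.Theory.
Local Open Scope ring_scope.

(** Equality of the two neighborhood sums allows cancelling the sum over the
    common part [C], and injectivity of the labeling then identifies the two
    remaining vertices. *)
Lemma distance_magic_exchange (V : finType) (adj : rel V) (Gamma : finZmodType)
    (x y u v : V) (C : {set V}) :
  distance_magic adj Gamma ->
  u \notin C -> v \notin C ->
  neighbors adj x = u |: C -> neighbors adj y = v |: C -> u = v.
Proof.
case=> l [[l' lK _] [mu sum_l]] uC vC Nx Ny; apply: (can_inj lK).
move: (sum_l x) (sum_l y); rewrite Nx Ny !big_setU1 //= => <- /addIr.
by move=> ->.
Qed.

Lemma Zp_two_neq0 (n : nat) : (3 <= n)%N -> (1 + 1 : 'Z_n) != 0.
Proof.
move=> n3; have n1 : (1 < n)%N by apply: ltnW.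
apply/eqP => two0; have := val_Zp_nat n1 2.
by rewrite modn_small // -[2%:R]/(1 + 1) two0.
Qed.

Lemma neighbors_outer1 (n : nat) :
  neighbors (@GP_adj n 1) (inl 1) =
    (inl (1 + 1) : GP_vertex n) |: [set inl 0; inr 1].
Proof.
apply/setP => -[] j; rewrite !inE /= ?orbF.
  rewrite -[RHS]/((j == 1 + 1) || (j == 0)); congr (_ || _).
  by rewrite -subr_eq subrr eq_sym.
by rewrite -[RHS]/(j == 1) eq_sym.
Qed.

Lemma neighbors_inner0 (n : nat) :
  neighbors (@GP_adj n 1) (inr 0) =
    (inr (- 1) : GP_vertex n) |: [set inl 0; inr 1].
Proof.
apply/setP => -[] j; rewrite !inE /= ?orbF.
  by rewrite -[RHS]/(j == 0) eq_sym.
rewrite -[RHS]/((j == - 1) || (j == 1)) add0r orbC; congr (_ || _).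
by rewrite eq_sym addr_eq0.
Qed.

Theorem mainTheorem3 (n : nat) (Gamma : finZmodType) :
  (3 <= n)%N -> #|Gamma| = (2 * n)%N -> ~ distance_magic (@GP_adj n 1) Gamma.
Proof.
move=> n3 _ magic; have two_neq0 := Zp_two_neq0 n n3.
have exchange := distance_magic_exchange _ _ _ _ _ _ _ _ magic _ _
  (neighbors_outer1 n) (neighbors_inner0 n).
(* The two exchanged vertices lie outside the common part because 2 is nonzero
   modulo n: this gives both x_2 <> x_0 and y_(-1) <> y_1. *)
suff [/exchange x2 /x2] : (inl (1 + 1) : GP_vertex n) \notin [set inl 0; inr 1] /\
    (inr (- 1) : GP_vertex n) \notin [set inl 0; inr 1] by [].
split; rewrite !inE.
  by rewrite orbF -[X in ~~ X]/(1 + 1 == 0 :> 'Z_n).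
by rewrite /= -[X in ~~ X]/(- 1 == 1 :> 'Z_n) eq_sym -addr_eq0.
Qed.
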